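(* Let $\mathcal J=\mathcal C_{n_1}(a_1,b_1)\oplus\cdots\oplus\mathcal C_{n_p}(a_p,b_p)$ with all $b_i>0$, a real $N\times N$ matrix, $N=2(n_1+\dots+n_p)$. Let $B\in\dot{\mathcal H}^{N}_{\mathcal J}$. Then there exist $S\in\dot{\mathcal T}_{\mathcal J}$ and an $N\times N$ permutation matrix $P$ such that $$S^{*}BS=\mathcal P\,P^tJ_{N}P.$$
   Context: $\mathcal C_n(a,b)$ is the $2n\times2n$ real Jordan block with $2\times2$ blocks $\begin{pmatrix}a&b\\-b&a\end{pmatrix}$ on the block diagonal and $I_2$ on the block superdiagonal. All $N\times N$ matrices $B=[B_{ij}]_{i,j=1}^p$ are partitioned into blocks $B_{ij}\in \mathrm M(2n_i\times 2n_j,\mathbb R)$, each viewed as an $n_i\times n_j$ array of $2\times2$ real matrices. $B_{ij}$ is 2-upper Toeplitz if, as such an array, $B_{ij}=(0\mid T)$ when $n_i\le n_j$, or $B_{ij}=\begin{pmatrix}T\\0\end{pmatrix}$ when $n_j\le n_i$, where $T$ is block upper triangular and block Toeplitz with $\min(n_i,n_j)$ block rows and columns; its $2\times 2$ coefficients along successive block diagonals (starting from the main diagonal of $T$) are denoted $b_{ij}^{(t)}$. $B$ is 2-$N$-upper Toeplitz if every $B_{ij}$ is 2-upper Toeplitz. Let $I^\pm_{n,2}=\mathrm{diag}(I_2,-I_2,I_2,\dots)$ ($n$ blocks) and $I^\pm=I^\pm_{n_1,2}\oplus\cdots\oplus I^{\pm}_{n_p,2}$; $B$ is 2-$N$-upper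 alternating Toeplitz if $B=I^\pm B'$ with $B'$ 2-$N$-upper Toeplitz. Let $\mathcal P=\mathcal P_{n_1,2}\oplus\cdots\oplus\mathcal P_{n_p,2}$, where $\mathcal P_{n,2}$ is the $2n\times2n$ matrix with $I_2$ on the block antidiagonal and zero elsewhere. Define $B^*=\mathcal PB^t\mathcal P$ (the 2-$N$-block star); $B$ is 2-$N$-skew-symmetric if $B^*=-B$. Let $J_2=\begin{pmatrix}0&1\\-1&0\end{pmatrix}$. Condition (c): every $2\times2$ coefficient $b_{ij}^{(t)}$ commutes with $J_2$. $\dot{\mathcal T}_{\mathcal J}$ is the set of invertible real 2-$N$-upper Toeplitz matrices $[A_{ij}]$ satisfying (c) with $A_{ij}=0$ whenever $(a_i,b_i)\ne(a_j,b_j)$. $\dot{\mathcal H}^K_{\mathcal J}$ is the set of real 2-$N$-skew-symmetric, 2-$N$-upper alternating Toeplitz matrices $[B_{ij}]$ of rank $K$ satisfying (c) with $B_{ij}=0$ whenever $(-a_i,b_i)\ne(a_j,b_j)$. For $N=2d$, $J_N=\begin{pmatrix}0&I_d\\-I_d&0\end{pmatrix}$. *)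

(* Defs.v *)
From HB Require Import structures.
From mathcomp Require Import all_boot all_order all_algebra.
From mathcomp Require Import reals.
Set Implicit Arguments.
Unset Strict Implicit.
Unset Printing Implicit Defensive.
Import Order.TTheory GRing.Theory Num.Theory.
Local Open Scope ring_scope.

(* A matrix of size 2n seen as an array of n x n blocks of size 2 has type
   'M_(arrdim n), so that its (k, l) coefficient is submxblock A k l : 'M_2.
   A matrix of size N = 2(n_1 + ... + n_p) partitioned according to the n_i
   has type 'M_(blkdim n), and its block B_ij is submxblock B i j.
   All block and coefficient indices start from 0. *)
Notation arrdim n := (\sum_(k < n) 2)%N.
Notation blkdim n := (\sum_i \sum_(k < n i) 2)%N.

Section Definitions.
Variable R : realType.

Definition Jmx (d : nat) : 'M[R]_(d + d) :=
  block_mx 0 1%:M (- 1%:M) 0.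

Definition J2 : 'M[R]_2 := Jmx 1.

Definition rot2 (a b : R) : 'M[R]_2 :=
  block_mx a%:M b%:M (- b)%:M a%:M : 'M_(1 + 1).

Definition jordan_block (n : nat) (a b : R) : 'M[R]_(arrdim n) :=
  \mxblock_(k < n, l < n)
    (if l == k then rot2 a b
     else if l == k.+1 :> nat then 1%:M else 0).

(* The two shapes (0 | T) for m <= n and (T over 0) for n <= m are treated at
   once: in both cases the diagonal of T starts at block column n - m
   (truncated subtraction), and for n <= m the condition k <= l makes the
   block rows k >= n vanish. Only b 0, ..., b (minn m n).-1 are used. *)
Definition upper_toeplitz2 (m n : nat) (b : nat -> 'M[R]_2)
    : 'M[R]_(arrdim m, arrdim n) :=
  \mxblock_(k < m, l < n)
    (if (k + (n - m) <= l)%N then b (l - (k + (n - m)))%N else 0).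

Section Blocks.
Variables (p : nat) (n : 'I_p -> nat) (a b : 'I_p -> R).

Definition jordan_mx : 'M[R]_(blkdim n) :=
  \mxdiag_(i < p) jordan_block (n i) (a i) (b i).

Definition alt_mx : 'M[R]_(blkdim n) :=
  \mxdiag_(i < p) \mxdiag_(k < n i) ((-1) ^+ k)%:M.

Definition flip_mx : 'M[R]_(blkdim n) :=
  \mxdiag_(i < p) \mxblock_(k < n i, l < n i)
    (if l == rev_ord k then 1%:M else 0 : 'M[R]_2).

Definition star (B : 'M[R]_(blkdim n)) : 'M[R]_(blkdim n) :=
  flip_mx *m B^T *m flip_mx.

Definition N_skew_symmetric (B : 'M[R]_(blkdim n)) : Prop := star B = - B.

Definition N_upper_toeplitz (c : 'I_p -> 'I_p -> nat -> 'M[R]_2)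
    (B : 'M[R]_(blkdim n)) : Prop :=
  forall i j, submxblock B i j = upper_toeplitz2 (n i) (n j) (c i j).

Definition N_upper_alt_toeplitz (c : 'I_p -> 'I_p -> nat -> 'M[R]_2)
    (B : 'M[R]_(blkdim n)) : Prop :=
  exists2 B' : 'M[R]_(blkdim n), N_upper_toeplitz c B' & B = alt_mx *m B'.

(* For an alternating Toeplitz B = alt_mx *m B', c lists the coefficients of B';
   those of B are the same up to sign, which does not affect commutation. *)
Definition coef_comm_J2 (c : 'I_p -> 'I_p -> nat -> 'M[R]_2) : Prop :=
  forall i j t, (t < minn (n i) (n j))%N -> comm_mx (c i j t) J2.

(* The sets T_J and H^K_J depend on J only through its data n, a, b. *)
Definition TJ (S : 'M[R]_(blkdim n)) : Prop :=
  [/\ S \in unitmx,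
      exists2 c, N_upper_toeplitz c S & coef_comm_J2 c
    & forall i j, (a i, b i) <> (a j, b j) -> submxblock S i j = 0].

Definition HJ (K : nat) (B : 'M[R]_(blkdim n)) : Prop :=
  [/\ N_skew_symmetric B,
      exists2 c, N_upper_alt_toeplitz c B & coef_comm_J2 c,
      \rank B = K
    & forall i j, (- a i, b i) <> (a j, b j) -> submxblock B i j = 0].

Lemma blkdimE : (\sum_i n i + \sum_i n i = blkdim n)%N.
Proof.
rewrite -big_split /=; apply: eq_bigr => i _.
by rewrite sum_nat_const card_ord muln2 addnn.
Qed.

Definition JN : 'M[R]_(blkdim n) :=
  castmx (blkdimE, blkdimE) (Jmx (\sum_i n i)).

End Blocks.
End Definitions.

(* Main.v *)
Require Import Defs.
From HB Require Import structures.
From mathcomp Require Import all_boot all_order all_algebra.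
From mathcomp Require Import reals.
From mathcomp Require Import fingroup perm zify lra complex.
Set Implicit Arguments.
Unset Strict Implicit.
Unset Printing Implicit Defensive.
Import Order.TTheory GRing.Theory Num.Theory.
Local Open Scope ring_scope.

(** Why the theorem holds.  Write F for the block flip.  Since star S = F S^T F
    with F an involution, F (star S) B S = S^T (F B) S, and F B is an
    invertible skew-symmetric real matrix; so S is a change of basis for a
    symplectic form.  A skew-symmetric signed permutation matrix is always of
    the form P^T J P (skew_signed_rows_JN), so it suffices to bring F B to
    such a matrix by an S of the prescribed shape.

    That shape is best described by commutation.  A matrix is block upper
    Toeplitz with coefficients commuting with J_2 exactly when it commutes
    with the nilpotent shift and with the complex structure (comm_toeplitz
    and its converses), which makes closure under products and inverses
    immediate; the vanishing of blocks between different (a, b) is the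
    condition called keyed below.

    Give the k-th coordinate pair of the i-th block the weight 2 k - n_i.  A
    Toeplitz matrix never raises weights when acting on columns, and its
    weight-preserving part only involves the leading coefficients between
    blocks of equal size: it is the image phi c of a p x p complex matrix c,
    since the 2 x 2 matrices commuting with J_2 form a copy of the complex
    numbers.  With alt the alternating sign matrix and B = alt M, this gives
    B = alt (phi c) (1 + Z) where Z strictly lowers weights, hence is
    nilpotent.  The matrix c is invertible (lead_unit).  From
    star B = - B one gets star Z (alt phi c) = (alt phi c) Z, so that
    congruence by a polynomial in Z acts as multiplication by its square; the
    inverse square root of 1 + Z is reached by Newton iteration, each step of
    which doubles the weight drop of Z (unipotent_congruence).  This replaces
    B by alt (phi c).

    What remains is a problem on c.  Skew-symmetry of alt (phi c) says that
    c is Hermitian up to the sign (-1)^n_i, and multiplying the rows of odd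
    blocks by i makes it Hermitian.  Gaussian elimination, with a pivot on the
    diagonal or a pair of isotropic pivots off the diagonal, followed by a
    rescaling, turns it into a matrix with one entry 1 or -1 in each row
    (hermitian_signed_matching), without mixing indices of different
    (n, a, b).  Undoing the phases leaves entries among 1, -1, i, -i, whose
    real 2 x 2 blocks are signed permutation matrices. *)
(** * Skew-symmetric signed permutation matrices *)
Section SignedPermutation.
Variable R : realType.

Definition signed_rows m (M : 'M[R]_m) := forall x,
  exists2 y, M x y = 1 \/ M x y = -1 & forall z, z != y -> M x z = 0.

Lemma signed_rows_mul m (M M' : 'M[R]_m) :
  signed_rows M -> signed_rows M' -> signed_rows (M *m M').
Proof.
move=> sM sM' x; have [y Mxy Mx0] := sM x; have [z Myz My0] := sM' y.
have E w : (M *m M') x w = M x y * M' y w.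
  by rewrite mxE (bigD1 y)//= big1 ?addr0// => v vy; rewrite Mx0// mul0r.
exists z; rewrite ?E; last by move=> w wz; rewrite E My0 ?mulr0.
by case: Mxy => ->; case: Myz => ->; rewrite ?mulrN ?mulNr ?mulr1 ?opprK;
  [left|right|right|left].
Qed.

Lemma signed_rows_unit m (M : 'M[R]_m) : M^T = - M -> signed_rows M ->
  M \in unitmx.
Proof.
move=> skM sM; rewrite -row_free_unit; apply: inj_row_free => v vM.
apply/rowP => x; have [y Mxy Mx0] := sM x.
have My0 z : z != x -> M z y = 0.
  move=> zx; have [w Mzw Mz0] := sM z; have [yw|yw] := eqVneq y w; last first.
    exact: Mz0.
  have nz u u' : M u u' = 1 \/ M u u' = -1 -> M u u' != 0.
    by case=> ->; rewrite ?oppr_eq0 oner_eq0.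
  have skE u u' : M u u' = - M u' u by rewrite -[in LHS](trmxK M) mxE skM mxE.
  have [t Myt My0] := sM y.
  have xt : x = t.
    apply/eqP; apply: contraNT (nz _ _ Mxy) => xt.
    by rewrite skE My0 ?oppr0.
  by rewrite skE My0 ?oppr0// -xt.
move/rowP: vM => /(_ y); rewrite !mxE (bigD1 x)//= big1 ?addr0; last first.
  by move=> z zx; rewrite My0 ?mulr0.
by case: Mxy => ->; rewrite ?mulrN mulr1 => /eqP; rewrite ?oppr_eq0 => /eqP.
Qed.

(** The rows of Q are matched in pairs by an involution without fixed points,
    and skew-symmetry gives opposite signs to the two rows of a pair.
    Numbering the rows with sign 1 first, and their partners in the same order
    after them, puts Q in the standard symplectic form. *)
Lemma skew_signed_rows_JN d m (e : (d + d = m)%N) (Q : 'M[R]_m) :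
  Q^T = - Q -> signed_rows Q ->
  exists2 P : 'M[R]_m, is_perm_mx P & Q = P^T *m castmx (e, e) (Jmx R d) *m P.
Proof.
case: m / e Q => Q skQ sQ; rewrite castmx_id.
have [sg sgP] : exists sg : 'I_(d + d) -> 'I_(d + d), forall x,
    (Q x (sg x) = 1 \/ Q x (sg x) = -1) /\ forall y, y != sg x -> Q x y = 0.
  apply: (@fin_all_exists _ (fun=> 'I_(d + d)) (fun x y =>
    (Q x y = 1 \/ Q x y = -1) /\ forall z, z != y -> Q x z = 0)) => x.
  by have [y] := sQ x; exists y.
have skE x y : Q x y = - Q y x by rewrite -[in LHS](trmxK Q) mxE skQ mxE.
have Qnz x : Q x (sg x) != 0.
  by have [[->|->] _] := sgP x; rewrite ?oppr_eq0 oner_eq0.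
have sgK x : sg (sg x) = x.
  apply/esym/eqP; apply: contraTT (Qnz x) => nsg.
  by rewrite skE; have [_ ->] := sgP (sg x); rewrite ?oppr0 ?eqxx.
pose A := [set x | Q x (sg x) == 1].
have AE x : (sg x \in A) = (x \notin A).
  rewrite !inE sgK skE; have [[->|->] _] := sgP x; rewrite ?opprK eqxx.
    by rewrite eqNr oner_eq0.
  by rewrite eqNr oner_eq0.
have cA : #|A| = d.
  have sgA : #|sg @: A| = #|A| by rewrite card_imset//; apply: can_inj sgK.
  have: (#|A| + #|~: A| = d + d)%N by rewrite cardsC card_ord.
  suff -> : ~: A = sg @: A by rewrite sgA; lia.
  apply/setP => x; rewrite inE; apply/idP/imsetP => [xA|[y yA ->]].
    by exists (sg x); rewrite ?sgK ?AE.
  by rewrite AE yA.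
pose ev (k : 'I_d) := enum_val (cast_ord (esym cA) k).
have evA k : ev k \in A by apply: enum_valP.
have ev_inj : injective ev.
  by move=> k l /enum_val_inj /cast_ord_inj.
pose rho u := match split u with inl k => ev k | inr k => sg (ev k) end.
have rho_inj : injective rho.
  move=> u v; rewrite /rho.
  case: splitP => k uk; case: splitP => l vl.
  - by move/ev_inj => kl; apply: val_inj; rewrite /= uk vl kl.
  - by move=> E; have := evA k; rewrite E AE evA.
  - by move=> E; have := evA l; rewrite -E AE evA.
  - move=> /(congr1 sg); rewrite !sgK => /ev_inj kl.
    by apply: val_inj; rewrite /= uk vl kl.
have rhol k : rho (lshift d k) = ev k by rewrite /rho (unsplitK (inl k)).
have rhor k : rho (rshift d k) = sg (ev k) by rewrite /rho (unsplitK (inr k)).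
pose r := perm rho_inj.
have JE : perm_mx r *m Q *m (perm_mx r)^T = Jmx R d.
  apply/matrixP => u v.
  rewrite tr_perm_mx -row_permE -col_permE 2![LHS]mxE !permE.
  have [k ->|k ->] := split_ordP u; have [l ->|l ->] := split_ordP v;
    rewrite ?block_mxEul ?block_mxEur ?block_mxEdl ?block_mxEdr ?rhol ?rhor.
  - rewrite !mxE; have [_ ->//] := sgP (ev k).
    by apply: contraTneq (evA l) => ->; rewrite AE evA.
  - rewrite !mxE; have [<-|kl] := eqVneq k l.
      by have := evA k; rewrite inE => /eqP.
    have [_ ->//] := sgP (ev k).
    by apply: contra_neq kl => /(can_inj sgK) /ev_inj.
  - rewrite !mxE; have [<-|kl] := eqVneq k l.
      by rewrite skE; have := evA k; rewrite inE => /eqP ->.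
    rewrite oppr0; have [_ ->//] := sgP (sg (ev k)); rewrite sgK.
    by apply: contra_neq kl => /ev_inj.
  - rewrite !mxE; have [_ ->//] := sgP (sg (ev k)); rewrite sgK.
    by apply: contraTneq (evA k) => <-; rewrite AE evA.
have rr : (perm_mx r)^T *m perm_mx r = 1%:M :> 'M[R]_(d + d).
  by rewrite tr_perm_mx -perm_mxM mulVg perm_mx1.
exists (perm_mx r); first exact: perm_mx_is_perm.
by rewrite -JE !mulmxA rr mul1mx -mulmxA rr mulmx1.
Qed.

End SignedPermutation.

(** * Matrices respecting a labelling of the indices *)
Section KeyedMatrices.
Variables (F : fieldType) (m : nat) (K : eqType) (key : 'I_m -> K).
Implicit Types (M : 'M[F]_m) (t : K -> K).

(** For t the identity these are the matrices without interaction between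
    different labels; a general t makes room for forms pairing the label
    (a, b) with (- a, b), and composes under products. *)
Definition keyed t M := forall i j, M i j != 0 -> key j = t (key i).

Lemma mulmx_neq0 (l q : nat) (A : 'M[F]_(l, m)) (B : 'M[F]_(m, q)) i j :
  (A *m B) i j != 0 -> exists2 k, A i k != 0 & B k j != 0.
Proof.
have [/existsP[k /andP[Ak Bk]] _|/existsPn nAB] :=
  boolP [exists k, (A i k != 0) && (B k j != 0)]; first by exists k.
rewrite mxE big1 ?eqxx// => k _; have := nAB k.
by rewrite negb_and !negbK => /orP[] /eqP->; rewrite ?mul0r ?mulr0.
Qed.

Lemma keyed_mul t t' M M' :
  keyed t M -> keyed t' M' -> keyed (t' \o t) (M *m M').
Proof. by move=> tM tM' i j /mulmx_neq0[k /tM ik /tM' kj]; rewrite kj ik. Qed.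

Lemma keyed_ext t t' M : t =1 t' -> keyed t M -> keyed t' M.
Proof. by move=> tt' tM i j /tM ->. Qed.

Lemma keyed1 : keyed id 1%:M.
Proof. by move=> i j; rewrite mxE; have [->|] := eqVneq i j; rewrite ?eqxx. Qed.

Lemma keyed_opp t M : keyed t M -> keyed t (- M).
Proof. by move=> tM i j; rewrite mxE oppr_eq0 => /tM. Qed.

Lemma keyed_scale t a M : keyed t M -> keyed t (a *: M).
Proof.
by move=> tM i j; rewrite mxE mulf_eq0 negb_or => /andP[_ /tM].
Qed.

Lemma keyed_add t M M' : keyed t M -> keyed t M' -> keyed t (M + M').
Proof.
move=> tM tM' i j; have [Mij|/tM //] := eqVneq (M i j) 0.
by rewrite mxE Mij add0r => /tM'.
Qed.

(** Being keyed amounts to intertwining every diagonal matrix D f attached to a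
    function f of the label with D (f \o t), a relation that passes to the
    inverse; the indicator function of one label then recovers the entries. *)
Lemma keyed_inv t M : involutive t -> M \in unitmx -> keyed t M ->
  keyed t (invmx M).
Proof.
move=> tK uM tM i j nz.
pose D (f : K -> F) := diag_mx (\row_k f (key k)).
have MD f : M *m D f = D (f \o t) *m M.
  apply/matrixP => k l; rewrite mul_diag_mx mul_mx_diag !mxE /= mulrC.
  have [->|/tM ->//] := eqVneq (M k l) 0; by rewrite !mulr0.
pose f k : F := (k == key i)%:R.
have : (D f *m invmx M) i j = (invmx M *m D (f \o t)) i j.
  by rewrite -[D f](mulKmx uM) MD !mulmxA mulmxK.
rewrite mul_diag_mx mul_mx_diag ![in RHS]mxE [in LHS]mxE [(\row_k _) _ _]mxE.
rewrite /f /= eqxx mul1r => E; move: nz; rewrite E.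
by case: (t (key j) =P key i) => [<-|_]; rewrite ?tK// mulr0 eqxx.
Qed.

End KeyedMatrices.

(** * Hermitian matrices up to block-compatible congruence *)
Section HermitianMatching.
Variables (C : numClosedFieldType) (p : nat).
Variables (K : eqType) (key : 'I_p -> K) (tau : K -> K).
Implicit Types c s : 'M[C]_p.

Definition adj s : 'M[C]_p := map_mx Num.conj s^T.

(** The state of the elimination: the indices in X are finished, each being
    paired with a single partner, possibly itself. *)
Definition matched (X : {set 'I_p}) c := forall i, i \in X ->
  exists2 j, j \in X & c i j != 0 /\ forall k, k != j -> c i k = 0.

Lemma adjE s i j : adj s i j = (s j i)^*.
Proof. by rewrite !mxE. Qed.

Lemma adj_mul s t : adj (s *m t) = adj t *m adj s.
Proof. by rewrite /adj trmx_mul map_mxM. Qed.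

Lemma adjK s : adj (adj s) = s.
Proof. by apply/matrixP => i j; rewrite !mxE conjCK. Qed.

Lemma keyed_congr s c :
  keyed key id s -> keyed key tau c -> keyed key tau (adj s *m c *m s).
Proof.
move=> cs ic i j /mulmx_neq0[k /mulmx_neq0[l]].
by rewrite !mxE conjC_eq0 => /cs -> /ic <- /cs.
Qed.

Lemma adj_congr s c : adj c = c -> adj (adj s *m c *m s) = adj s *m c *m s.
Proof. by move=> hc; rewrite !adj_mul adjK hc mulmxA. Qed.

Lemma hermitian_neq0 c i j : adj c = c -> (c i j != 0) = (c j i != 0).
Proof. by move=> hc; rewrite -{1}hc !mxE conjC_eq0. Qed.

(** One elimination step with the pivot entry c i j.  The pivots are the
    indices P = {i, j}, exchanged by sw; the hypothesis on the diagonal makes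
    the restriction of c to P monomial, so a multiple of the basis vector l in
    P can be subtracted from any vector k outside P to make it orthogonal to
    the vector sw l.  The subtracted multiple is nonzero only if k and sw l
    are paired by c, hence only if k has the label of l. *)
Lemma eliminate (X : {set 'I_p}) c i j :
  adj c = c -> keyed key tau c -> matched X c ->
  i \notin X -> j \notin X -> c i j != 0 ->
  i = j \/ c i i = 0 /\ c j j = 0 ->
  exists s, [/\ s \in unitmx, keyed key id s
    & matched (i |: (j |: X)) (adj s *m c *m s)].
Proof.
move=> hc ic mX iX jX cij0 dij.
pose P := [set i; j]; pose sw := tperm i j.
have swP l : l \in P -> sw l \in P.
  by rewrite !inE => /orP[]/eqP->; rewrite ?tpermL ?tpermR eqxx ?orbT.
have PX l : l \in P -> l \notin X by rewrite !inE => /orP[]/eqP->.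
have cP l : l \in P -> c l (sw l) != 0.
  rewrite !inE => /orP[]/eqP->; rewrite ?tpermL ?tpermR//.
  by rewrite hermitian_neq0.
have cPP l m : l \in P -> m \in P -> m != sw l -> c l m = 0.
  rewrite !inE /sw; case: dij => [->|[cii cjj]].
    by rewrite !orbb => /eqP-> /eqP->; rewrite tpermL eqxx.
  by move=> /orP[]/eqP-> /orP[]/eqP->; rewrite ?tpermL ?tpermR ?eqxx.
have cXP l m : l \in X -> m \notin X -> c l m = 0.
  move=> lX mX'; have [k kX [_ ->//]] := mX _ lX.
  by apply: contraNneq mX' => ->.
have cPX l m : l \in X -> m \notin X -> c m l = 0.
  move=> lX mX'; apply/eqP; rewrite -[_ == 0]negbK hermitian_neq0// negbK.
  by rewrite cXP.
pose e : 'M[C]_p := \matrix_(l, k)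
  if (l \in P) && (k \notin P) then c (sw l) k / c (sw l) l else 0.
(* e maps vectors outside P into the span of P, so it squares to 0 *)
have ee : e *m e = 0.
  apply/matrixP => l k; rewrite !mxE big1// => m _; rewrite !mxE.
  by case: (m \in P); rewrite ?andbF ?mul0r ?mulr0.
pose s := 1%:M - e.
have scol l : l \in P :|: X -> forall m, s m l = (m == l)%:R.
  move=> lPX m; rewrite !mxE.
  have [mP|] := boolP (m \in P); last by rewrite subr0.
  have [lP|lP] := boolP (l \in P); first by rewrite subr0.
  have lX : l \in X by move: lPX; rewrite inE (negPf lP).
  by rewrite cPX ?mul0r ?subr0// PX// swP.
have rowE l k : l \in P :|: X -> (adj s *m c *m s) l k = (c *m s) l k.
  move=> lPX; rewrite -mulmxA mxE (bigD1 l)//= big1 ?addr0.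
    by rewrite adjE scol// eqxx conjC1 mul1r.
  by move=> m ml; rewrite adjE scol// (negPf ml) conjC0 mul0r.
have csE l k : (c *m s) l k = c l k - \sum_m c l m * e m k.
  by rewrite mulmxBr mulmx1 !mxE.
exists s; split.
- suff /mulmx1_unit[]: s *m (1%:M + e) = 1%:M by [].
  by rewrite mulmxDr mulmx1 mulmxBl ee mul1mx subr0 subrK.
- move=> l k; rewrite !mxE; have [->//|lk] := eqVneq l k.
  rewrite sub0r oppr_eq0; case: ifP => [/andP[lP kP]|]; last by rewrite eqxx.
  rewrite mulf_eq0 invr_eq0 negb_or => /andP[/ic-> clk].
  exact/esym/(ic _ _ clk).
rewrite setUA -/P => l lPX; have [lP|lP] := boolP (l \in P).
  have sumE k : (c *m s) l k = if k \in P then c l k else 0.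
    rewrite csE (bigD1 (sw l))//= big1 ?addr0; last first.
      move=> m ml; rewrite !mxE; case: ifP => [/andP[mP _]|]; last first.
        by rewrite mulr0.
      by rewrite cPP// mul0r.
    rewrite !mxE swP//=; have [_|_] /= := boolP (k \in P).
      by rewrite mulr0 subr0.
    by rewrite tpermK mulrC divfK ?subrr ?cP.
  exists (sw l); first by rewrite inE swP.
  split=> [|k kl]; rewrite rowE// sumE; first by rewrite swP// cP.
  by case: ifP => // kP; rewrite cPP.
have lX : l \in X by move: lPX; rewrite inE (negPf lP).
have sumE k : (c *m s) l k = c l k.
  rewrite csE big1 ?subr0// => m _; rewrite !mxE.
  case: ifP => [/andP[mP _]|]; last by rewrite mulr0.
  by rewrite cXP ?mul0r// PX.
have [k kX [clk kP]] := mX l lX.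
exists k; rewrite ?inE ?kX ?orbT// rowE// sumE; split=> // m mk.
by rewrite rowE// sumE kP.
Qed.

(** If some unfinished diagonal entry is nonzero, it serves as pivot; if none
    is, any nonzero entry in an unfinished row serves, its two diagonal
    entries being zero. *)
Lemma hermitian_matching c :
  adj c = c -> c \in unitmx -> keyed key tau c ->
  exists2 s, keyed key id s & matched setT (adj s *m c *m s).
Proof.
suff H k (X : {set 'I_p}) : (#|~: X| <= k)%N -> forall c, adj c = c ->
    c \in unitmx -> keyed key tau c -> matched X c ->
    exists2 s, keyed key id s & matched setT (adj s *m c *m s).
  move=> hc uc ic; apply: (H #|~: (set0 : {set 'I_p})| set0) => // i.
  by rewrite inE.
elim: k X => [|k IH] X cX {}c hc uc ic mX.
  exists 1%:M; first exact: keyed1.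
  move: cX; rewrite leqn0 cards_eq0 => /eqP /(congr1 (@setC _)).
  rewrite setCK setC0 => <-.
  by rewrite mulmx1 /adj trmx1 map_mx1 mul1mx.
have [/eqP X0|[i0]] := set_0Vmem (~: X).
  by apply: (IH X) => //; rewrite (eqP X0) cards0.
rewrite inE => i0X.
have [i [j [iX jX cij0 dij]]] : exists i j, [/\ i \notin X, j \notin X,
    c i j != 0 & i = j \/ c i i = 0 /\ c j j = 0].
  have [/existsP[i /andP[iX cii]]|/existsPn diag0] :=
    boolP [exists i, (i \notin X) && (c i i != 0)].
    by exists i, i; split=> //; left.
  have d0 l : l \notin X -> c l l = 0.
    by move=> lX; apply/eqP; move: (diag0 l); rewrite lX negbK.
  have [j cj] : exists j, c i0 j != 0.
    apply/existsP; apply: contraLR uc => /existsPn c0.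
    rewrite -row_free_unit; apply/row_freePn; exists i0.
    suff ->: row i0 c = 0 by apply: sub0mx.
    by apply/rowP => j; rewrite !mxE; apply/eqP; rewrite -[_ == _]negbK c0.
  have jX : j \notin X.
    apply: contra cj => jX; rewrite -[_ == _]negbK hermitian_neq0// negbK.
    have [l lX [_ ->//]] := mX _ jX.
    by apply: contraNneq i0X => ->.
  by exists i0, j; split=> //; right; rewrite !d0.
have [s [us cs ms]] := eliminate hc ic mX iX jX cij0 dij.
have [| | | |t ct mt] := IH (i |: (j |: X)) _ (adj s *m c *m s) _ _ _ ms.
- rewrite -ltnS; apply: leq_trans cX; apply: proper_card.
  apply/properP; split; last by exists i; rewrite !inE ?eqxx.
  by rewrite setCS; apply/subsetP => l; rewrite !inE => ->; rewrite !orbT.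
- exact: adj_congr.
- by rewrite !unitmx_mul us uc /adj map_unitmx unitmx_tr us.
- exact: keyed_congr.
exists (s *m t); first exact: (keyed_mul cs ct).
by rewrite adj_mul !mulmxA in mt *.
Qed.

(** After the matching only a diagonal rescaling t is left.  A fixed index
    carries a real entry, normalised to its sign by the square root of its
    absolute value; in a pair, one vector is kept and the other is divided by
    the entry that pairs them. *)
Lemma hermitian_signed_matching c :
  adj c = c -> c \in unitmx -> keyed key tau c ->
  exists s (sg : 'I_p -> 'I_p) (th : 'I_p -> C), [/\ keyed key id s,
    forall i, th i = 1 \/ th i = -1
    & forall i j, (adj s *m c *m s) i j = if j == sg i then th i else 0].
Proof.
move=> hc uc ic; have [s cs ms] := hermitian_matching hc uc ic.
pose d := adj s *m c *m s.
have hd : adj d = d by apply: adj_congr.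
have [sg sgP] : exists sg : 'I_p -> 'I_p, forall i,
    d i (sg i) != 0 /\ forall k, k != sg i -> d i k = 0.
  apply: (@fin_all_exists _ (fun=> 'I_p) (fun i j => d i j != 0 /\
    forall k, k != j -> d i k = 0)) => i.
  by have [j _ dj] := ms i (in_setT i); exists j.
have sgK i : sg (sg i) = i.
  apply/esym/eqP; have [di _] := sgP i; apply: contraTT di => nsg.
  by rewrite hermitian_neq0// negbK; have [_ ->] := sgP (sg i).
have dC i j : (d i j)^* = d j i by rewrite -[in RHS]hd !mxE.
pose t i := if sg i == i then (sqrtC `|d i i|)^-1
            else if (i < sg i)%N then 1 else (d (sg i) i)^-1.
pose t' : 'M[C]_p := \matrix_(i, j) if i == j then t i else 0.
have t'E i j : (adj t' *m d *m t') i j = (t i)^* * d i j * t j.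
  rewrite mxE (bigD1 j)//= big1 ?addr0.
    rewrite !mxE eqxx (bigD1 i)//= big1 ?addr0 ?mxE ?eqxx// => k ki.
    by rewrite !mxE (negPf ki) conjC0 mul0r.
  by move=> k kj; rewrite !mxE (negPf kj) mulr0.
exists (s *m t'), sg, (fun i => (t i)^* * d i (sg i) * t (sg i)); split.
- suff: keyed key id t' by apply: keyed_mul cs.
  move=> i j; rewrite mxE.
  by have [->|] := eqVneq i j; rewrite ?eqxx.
- move=> i; have [di0 _] := sgP i.
  rewrite /t sgK [i == sg i]eq_sym; case: eqP => [sgi|/eqP sgi].
    rewrite sgi in di0 *.
    have r0 : `|d i i| != 0 by rewrite normr_eq0.
    have dR : d i i \is Num.real by rewrite CrealE dC.
    rewrite conj_Creal; last first.
      by rewrite rpredV ger0_real// sqrtC_ge0 normr_ge0.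
    rewrite mulrC mulrA -invfM -expr2 sqrtCK.
    have [d0|d0] := real_ge0P dR; first by left; rewrite mulVf.
    by right; rewrite invrN mulNr mulVf // ltr0_neq0.
  left; have [lt_i|ge_i] := ltnP i (sg i).
    by rewrite ltnNge (ltnW lt_i)/= conjC1 mul1r divff.
  have -> : (sg i < i)%N by rewrite ltn_neqAle sgi.
  by rewrite mulr1 fmorphV/= dC mulVf.
move=> i j; rewrite adj_mul !mulmxA -[_ *m adj s *m _]mulmxA.
rewrite -[_ *m (adj s *m _) *m _]mulmxA -/d t'E.
case: eqP => [->//|/eqP ji]; have [_ ->//] := sgP i.
by rewrite mulr0 mul0r.
Qed.

End HermitianMatching.

(** * Coordinates of block matrices *)
Lemma sum_Rank (V : nmodType) (m : nat) (p_ : 'I_m -> nat)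
    (f : 'I_(\sum_i p_ i) -> V) :
  \sum_x f x = \sum_i \sum_(j < p_ i) f (tagnat.Rank i j).
Proof.
rewrite [RHS]sig_big_dep/= (reindex _ (onW_bij _ (@tagnat.sig_bij _ _)))/=.
by apply: eq_bigr => x _; rewrite tagnat.sig2K.
Qed.

Section Indices.
Variables (p : nat) (n : 'I_p -> nat).
Implicit Types x y z : 'I_(blkdim n).

(** An index of a block matrix is a triple: the block blk, the position pos in
    the array of 2 x 2 coefficients, and the coordinate bit in a coefficient.
    The position is a plain number, which avoids a type depending on blk. *)
Definition blk x : 'I_p := tagnat.sig1 x.
Definition pos x : nat := tagnat.sig1 (tagnat.sig2 x).
Definition bit x : 'I_2 := tagnat.sig2 (tagnat.sig2 x).
Definition idx i (k : 'I_(n i)) (e : 'I_2) : 'I_(blkdim n) :=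
  tagnat.Rank i (tagnat.Rank k e).

Lemma pos_lt x : (pos x < n (blk x))%N. Proof. exact: ltn_ord. Qed.

Lemma idxK x : idx (tagnat.sig1 (tagnat.sig2 x)) (bit x) = x.
Proof. by rewrite /idx !tagnat.sig2K. Qed.

Lemma sig1_cast (m m' : nat) (e : m = m') (x : 'I_(arrdim m))
    (f : arrdim m = arrdim m') :
  tagnat.sig1 (cast_ord f x) = tagnat.sig1 x :> nat.
Proof. by case: m' / e f => f; rewrite cast_ord_id. Qed.

Lemma sig2_cast (m m' : nat) (e : m = m') (x : 'I_(arrdim m))
    (f : arrdim m = arrdim m') :
  tagnat.sig2 (cast_ord f x) = tagnat.sig2 x :> nat.
Proof. by case: m' / e f => f; rewrite cast_ord_id. Qed.

Lemma blk_idx i (k : 'I_(n i)) e : blk (idx k e) = i.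
Proof. by rewrite /blk tagnat.Rank1K. Qed.

Lemma pos_idx i (k : 'I_(n i)) e : pos (idx k e) = k.
Proof.
rewrite /pos /idx tagnat.Rank2K sig1_cast ?tagnat.Rank1K//.
Qed.

Lemma bit_idx i (k : 'I_(n i)) e : bit (idx k e) = e.
Proof.
apply: val_inj; rewrite /bit /idx tagnat.Rank2K.
apply: etrans (sig2_cast _ _ _) _; first by rewrite tagnat.Rank1K.
by rewrite tagnat.Rank2K.
Qed.

Lemma eq_idx i j (k : 'I_(n i)) (l : 'I_(n j)) e :
  i = j -> k = l :> nat -> idx k e = idx l e.
Proof. by move=> ij; case: j / ij l => l /ord_inj ->. Qed.

Lemma idx_inj x y : blk x = blk y -> pos x = pos y -> bit x = bit y -> x = y.
Proof.
move=> bxy pxy exy; rewrite -(idxK x) -(idxK y) exy.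
exact: eq_idx.
Qed.

Lemma sum_idx (V : nmodType) (F : 'I_(blkdim n) -> V) :
  \sum_x F x = \sum_i \sum_(k < n i) \sum_e F (idx k e).
Proof.
rewrite sum_Rank; apply: eq_bigr => i _.
exact: (sum_Rank (fun j => F (tagnat.Rank i j))).
Qed.

Lemma idx_eqE i j (k : 'I_(n i)) (l : 'I_(n j)) e f :
  (idx k e == idx l f) = [&& i == j, k == l :> nat & e == f].
Proof.
apply/eqP/and3P => [E|[/eqP ij /eqP kl /eqP ->]]; last exact: eq_idx.
split; apply/eqP; first by rewrite -(blk_idx k e) E blk_idx.
  by rewrite -(pos_idx k e) E pos_idx.
by rewrite -(bit_idx k e) E bit_idx.
Qed.

Lemma mxdiag_same (V : nmodType) (m : nat) (p_ : 'I_m -> nat)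
    (D : forall i, 'M[V]_(p_ i)) i k l :
  (\mxdiag_i D i) (tagnat.Rank i k) (tagnat.Rank i l) = D i k l.
Proof.
transitivity (submxblock (\mxdiag_i D i) i i k l); first by rewrite [RHS]mxE.
by rewrite submxblock_diag.
Qed.

Lemma mxdiag_diff (V : nmodType) (m : nat) (p_ : 'I_m -> nat)
    (D : forall i, 'M[V]_(p_ i)) i j k l : i != j ->
  (\mxdiag_i D i) (tagnat.Rank i k) (tagnat.Rank j l) = 0.
Proof.
move=> /negPf ij; transitivity (submxblock (\mxdiag_i D i) i j k l).
  by rewrite [RHS]mxE.
by rewrite mxblockK ij mxE.
Qed.

Lemma mxblock_Rank (T : Type) (m m' : nat) (p_ : 'I_m -> nat)
    (q_ : 'I_m' -> nat) (D : forall i j, 'M[T]_(p_ i, q_ j)) i j k l :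
  (\mxblock_(i, j) D i j) (tagnat.Rank i k) (tagnat.Rank j l) = D i j k l.
Proof.
transitivity (submxblock (\mxblock_(i, j) D i j) i j k l).
  by rewrite [RHS]mxE.
by rewrite mxblockK.
Qed.

Variable R : realType.

Lemma alt_mxE x y : alt_mx R n x y = (x == y)%:R * (-1) ^+ pos x.
Proof.
rewrite -(idxK x) -(idxK y) idx_eqE pos_idx.
move: (tagnat.sig1 (tagnat.sig2 x)) (tagnat.sig1 (tagnat.sig2 y)).
move: (tagnat.sig1 x) (tagnat.sig1 y) (bit x) (bit y) => i j e f k l.
case: (eqVneq i j) l => [<-|ij] l /=; last by rewrite mxdiag_diff// mul0r.
rewrite mxdiag_same; case: (eqVneq k l) => [<-|kl].
  by rewrite mxdiag_same mxE eqxx/= mulr_natl.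
by rewrite mxdiag_diff// -[_ == _ :> nat]/(k == l) (negPf kl) mul0r.
Qed.

Lemma flip_mxE x y : flip_mx R n x y =
  [&& blk x == blk y, (pos x + pos y).+1 == n (blk x) & bit x == bit y]%:R.
Proof.
rewrite -(idxK x) -(idxK y) !blk_idx !pos_idx !bit_idx.
move: (tagnat.sig1 (tagnat.sig2 x)) (tagnat.sig1 (tagnat.sig2 y)).
move: (tagnat.sig1 x) (tagnat.sig1 y) (bit x) (bit y) => i j e f k l.
case: (eqVneq i j) l => [<-|ij] l /=; last by rewrite mxdiag_diff.
rewrite mxdiag_same mxblock_Rank.
have -> : (l == rev_ord k) = ((k + l).+1 == n i)%N.
  by rewrite -val_eqE/=; have := ltn_ord k; lia.
by case: ifP => _; rewrite mxE.
Qed.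

Lemma upper_toeplitzP c B : N_upper_toeplitz c B <-> forall x y, B x y =
  if (pos x + (n (blk y) - n (blk x)) <= pos y)%N then
    c (blk x) (blk y) (pos y - (pos x + (n (blk y) - n (blk x))))%N
      (bit x) (bit y)
  else 0 :> R.
Proof.
have E i j (k : 'I_(n i)) (l : 'I_(n j)) e f :
    upper_toeplitz2 (n i) (n j) (c i j) (tagnat.Rank k e) (tagnat.Rank l f) =
    if (k + (n j - n i) <= l)%N then c i j (l - (k + (n j - n i)))%N e f
    else 0 :> R.
  by rewrite mxblock_Rank; case: ifP => //; rewrite mxE.
split=> [BT x y|BE i j].
  have /matrixP/(_ (tagnat.sig2 x) (tagnat.sig2 y)) :=
    BT (tagnat.sig1 x) (tagnat.sig1 y).
  rewrite mxE !tagnat.sig2K => ->.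
  by rewrite -[tagnat.sig2 x]tagnat.sig2K -[tagnat.sig2 y]tagnat.sig2K E.
apply/matrixP => u v; rewrite mxE BE.
rewrite -[u]tagnat.sig2K -[v]tagnat.sig2K E.
rewrite -[tagnat.Rank i _]/(idx _ _) -[tagnat.Rank j _]/(idx _ _).
by rewrite !blk_idx !pos_idx !bit_idx.
Qed.

Lemma submxblock_eq0 (B : 'M[R]_(blkdim n)) i j :
  submxblock B i j = 0 <-> forall x y, blk x = i -> blk y = j -> B x y = 0.
Proof.
split=> [B0 x y xi yj|B0]; last first.
  by apply/matrixP => u v; rewrite !mxE B0// /blk tagnat.Rank1K.
case: _ / xi B0 => B0; case: _ / yj B0 => /matrixP.
by move=> /(_ (tagnat.sig2 x) (tagnat.sig2 y)); rewrite !mxE !tagnat.sig2K.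
Qed.

Opaque idx blk pos bit.

Hypothesis n_gt0 : forall i, (0 < n i)%N.

(** Total version of idx, meaningful for positions k < n i. *)
Definition at_pos i k e := idx (insubd (Ordinal (n_gt0 i)) k) e.

Lemma blk_at i k e : blk (at_pos i k e) = i.
Proof. exact: blk_idx. Qed.

Lemma pos_at i k e : (k < n i)%N -> pos (at_pos i k e) = k.
Proof. by move=> ki; rewrite pos_idx val_insubd ki. Qed.

Lemma bit_at i k e : bit (at_pos i k e) = e.
Proof. exact: bit_idx. Qed.

Opaque at_pos.

Lemma at_posK x : at_pos (blk x) (pos x) (bit x) = x.
Proof.
by apply: idx_inj; rewrite ?blk_at ?bit_at ?pos_at// pos_lt.
Qed.

Lemma at_pos_ind (P : 'I_(blkdim n) -> Prop) :
  (forall i k e, (k < n i)%N -> P (at_pos i k e)) -> forall x, P x.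
Proof. by move=> Px x; rewrite -(at_posK x); apply/Px/pos_lt. Qed.

Lemma sum_at_pos (V : nmodType) (F : 'I_(blkdim n) -> V) :
  \sum_x F x = \sum_i \sum_(k < n i) \sum_e F (at_pos i k e).
Proof.
rewrite sum_idx; apply: eq_bigr => i _; apply: eq_bigr => k _.
apply: eq_bigr => e _; suff -> : idx k e = at_pos i k e by [].
apply: idx_inj; first by rewrite blk_idx blk_at.
  by rewrite pos_idx pos_at.
by rewrite bit_idx bit_at.
Qed.

Lemma sum_same_pos (V : nmodType) (F : 'I_(blkdim n) -> V) (I : {pred 'I_p})
    (k : nat) :
  (forall i, i \in I -> k < n i)%N ->
  (forall x, ~~ ((blk x \in I) && (pos x == k)) -> F x = 0) ->
  \sum_x F x = \sum_(i in I) \sum_e F (at_pos i k e).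
Proof.
move=> kI F0; rewrite sum_at_pos [RHS]big_mkcond; apply: eq_bigr => i _.
have [iI|iI] := ifPn; last first.
  rewrite big1// => l _; rewrite big1// => e _.
  by rewrite F0// blk_at (negPf iI).
rewrite (bigD1 (Ordinal (kI i iI)))//= [X in _ + X]big1 ?addr0// => l lk.
by rewrite big1// => e _; rewrite F0// blk_at iI pos_at.
Qed.

(** The permutation of the indices whose matrix is the block flip. *)
Definition mirror x := at_pos (blk x) (n (blk x) - (pos x).+1) (bit x).

Lemma blk_mirror x : blk (mirror x) = blk x. Proof. exact: blk_at. Qed.

Lemma pos_mirror x : pos (mirror x) = (n (blk x) - (pos x).+1)%N.
Proof. by rewrite pos_at//; have := pos_lt x; lia. Qed.

Lemma bit_mirror x : bit (mirror x) = bit x. Proof. exact: bit_at. Qed.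

Lemma mirrorK x : mirror (mirror x) = x.
Proof.
apply: idx_inj; rewrite ?blk_mirror ?bit_mirror// !pos_mirror blk_mirror.
by have := pos_lt x; lia.
Qed.

End Indices.

(** * Complex numbers as real matrices of size 2 *)
Section Complex.
Variable R : realType.
Implicit Types z w : R[i].

Definition cmx z : 'M[R]_2 := rot2 (complex.Re z) (complex.Im z).

Lemma cmxE z e f : cmx z e f =
  if e == f then complex.Re z else if e == ord0 then complex.Im z
  else - complex.Im z.
Proof.
have [i ->|i ->] := split_ordP (e : 'I_(1 + 1));
  have [j ->|j ->] := split_ordP (f : 'I_(1 + 1));
  [ apply: etrans (block_mxEul _ _ _ _ _ _) _
  | apply: etrans (block_mxEur _ _ _ _ _ _) _
  | apply: etrans (block_mxEdl _ _ _ _ _ _) _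
  | apply: etrans (block_mxEdr _ _ _ _ _ _) _ ];
  by rewrite mxE !ord1.
Qed.

Lemma J2E : J2 R = cmx 'i.
Proof. by rewrite /J2 /Jmx /cmx /rot2 /= raddfN raddf0. Qed.

Lemma cmxM z w : cmx (z * w) = cmx z *m cmx w.
Proof.
apply/matrixP => e f; rewrite [RHS]mxE !big_ord_recl big_ord0 !cmxE.
case: z w => [a b] [c d] /=.
case: e => [[|[|//]] ?]; case: f => [[|[|//]] ?] /=; lra.
Qed.

Fact cmx_is_additive : additive cmx.
Proof.
move=> [a b] [c d]; apply/matrixP => e f.
rewrite [RHS]mxE [X in _ = _ + X]mxE !cmxE /=.
by case: ifP => _ //; case: ifP => _ //; lra.
Qed.

HB.instance Definition _ := GRing.isAdditive.Build R[i] 'M[R]_2 cmx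
  cmx_is_additive.

Lemma cmxN z : cmx (- z) = - cmx z.
Proof. exact: raddfN. Qed.

Lemma cmx0 : cmx 0 = 0.
Proof. exact: raddf0. Qed.

Lemma cmx1 : cmx 1 = 1%:M.
Proof.
apply/matrixP => e f; rewrite cmxE mxE /=.
by case: ifP => _ //; case: ifP => _ //; rewrite oppr0.
Qed.

Lemma cmx_conj z : cmx z^* = (cmx z)^T.
Proof.
apply/matrixP => e f; rewrite [RHS]mxE !cmxE; case: z => a b /=.
by case: e => [[|[|//]] ?]; case: f => [[|[|//]] ?] //=; rewrite opprK.
Qed.

Lemma cmx_inj : injective cmx.
Proof.
move=> [a b] [c d] /matrixP E.
move: (E ord0 ord0) (E ord0 ord_max); rewrite !cmxE /=.
by move=> -> ->.
Qed.

Lemma comm_J2P (M : 'M[R]_2) :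
  comm_mx M (J2 R) <-> M = cmx (M ord0 ord0 +i* M ord0 ord_max)%C.
Proof.
split=> [|->]; last by rewrite J2E /comm_mx -!cmxM mulrC.
rewrite J2E => /matrixP E; apply/matrixP => e f; rewrite cmxE /=.
have ME i j : (M *m cmx 'i) i j = (cmx 'i *m M) i j := E i j.
move: (ME ord0 ord0) (ME ord0 ord_max); rewrite ![(_ *m _) _ _]mxE.
rewrite !big_ord_recl !big_ord0 !cmxE /=.
have -> : lift ord0 ord0 = ord_max :> 'I_2 by apply: val_inj.
case: e => [[|[|//]] e2]; case: f => [[|[|//]] f2] /=.
- by move=> _ _; congr (M _ _); apply: val_inj.
- by move=> _ _; congr (M _ _); apply: val_inj.
- move=> E1 _; have -> : Ordinal e2 = ord_max by apply: val_inj.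
  have -> : Ordinal f2 = ord0 by apply: val_inj.
  lra.
move=> _ E2; have -> : Ordinal e2 = ord_max by apply: val_inj.
have -> : Ordinal f2 = ord_max by apply: val_inj.
lra.
Qed.

Lemma signed_rows_cmx z : z = 1 \/ z = -1 \/ z = 'i \/ z = - 'i ->
  signed_rows (cmx z).
Proof.
have s1 : signed_rows (1%:M : 'M[R]_2).
  move=> x; exists x; first by left; rewrite mxE eqxx.
  by move=> y; rewrite mxE eq_sym => /negPf->.
have sJ : signed_rows (cmx 'i).
  move=> x; exists (rev_ord x); rewrite ?cmxE.
    by case: x => [[|[|//]] ?] /=; [left|right].
  by move=> y; rewrite cmxE; case: x => [[|[|//]] ?]; case: y => [[|[|//]] ?].
have sN M : signed_rows M -> signed_rows (- M : 'M[R]_2).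
  move=> sM x; have [y My M0] := sM x; exists y; rewrite ?mxE.
    by case: My => ->; rewrite ?opprK; [right|left].
  by move=> w /M0; rewrite mxE => ->; rewrite oppr0.
by move=> [->|[->|[->|->]]]; rewrite ?cmxN ?cmx1//; apply: sN.
Qed.

Opaque cmx.

End Complex.

(** * The star operation and constant block matrices *)
Section BlockMatrices.
Variables (R : realType) (p : nat) (n : 'I_p -> nat).
Hypothesis n_gt0 : forall i, (0 < n i)%N.
Notation N := (blkdim n).
Notation at_pos := (at_pos n_gt0).
Notation mirror := (mirror n_gt0).
Notation alt := (alt_mx R n).
Notation flip := (flip_mx R n).
Implicit Types (x y z : 'I_N) (M : 'M[R]_N) (c d : 'M[R[i]]_p).

Lemma mul_altl M x y : (alt *m M) x y = (-1) ^+ pos x * M x y.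
Proof.
rewrite mxE (bigD1 x)//= [X in _ + X]big1 ?addr0 ?alt_mxE ?eqxx ?mul1r//.
move=> z zx.
by rewrite alt_mxE eq_sym (negPf zx) !mul0r.
Qed.

Lemma mul_altr M x y : (M *m alt) x y = M x y * (-1) ^+ pos y.
Proof.
rewrite mxE (bigD1 y)//= [X in _ + X]big1 ?addr0 ?alt_mxE ?eqxx ?mul1r//.
move=> z zx.
by rewrite alt_mxE (negPf zx) mul0r mulr0.
Qed.

Lemma alt_mxK M : alt *m (alt *m M) = M.
Proof.
by apply/matrixP => x y; rewrite !mul_altl mulrA -expr2 sqrr_sign mul1r.
Qed.

Lemma flip_mirrorE x y : flip x y = (y == mirror x)%:R.
Proof.
rewrite flip_mxE; congr (nat_of_bool _)%:R; apply/idP/eqP => [|->].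
  move=> /and3P[/eqP bxy /eqP pxy /eqP exy]; apply: idx_inj.
  - by rewrite blk_mirror.
  - by rewrite pos_mirror; have := pos_lt x; lia.
  by rewrite bit_mirror.
rewrite blk_mirror bit_mirror pos_mirror !eqxx andbT /=.
by apply/eqP; have := pos_lt x; lia.
Qed.

Lemma mul_flipl M x y : (flip *m M) x y = M (mirror x) y.
Proof.
rewrite mxE (bigD1 (mirror x))//= [X in _ + X]big1 ?addr0.
  by rewrite flip_mirrorE eqxx mul1r.
by move=> z zx; rewrite flip_mirrorE (negPf zx) mul0r.
Qed.

Lemma mul_flipr M x y : (M *m flip) x y = M x (mirror y).
Proof.
rewrite mxE (bigD1 (mirror y))//= [X in _ + X]big1 ?addr0.
  by rewrite flip_mirrorE mirrorK eqxx mulr1.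
move=> z zx; rewrite flip_mirrorE [y == _](_ : _ = false) ?mulr0//.
by apply: contra_neqF zx => /eqP ->; rewrite mirrorK.
Qed.

Lemma flip_mxK M : flip *m (flip *m M) = M.
Proof. by apply/matrixP => x y; rewrite !mul_flipl mirrorK. Qed.

Lemma flip_flip : flip *m flip = 1%:M.
Proof. by rewrite -[LHS]mulmx1 -mulmxA flip_mxK. Qed.

Lemma tr_flip : flip^T = flip.
Proof.
apply/matrixP => x y; rewrite mxE !flip_mirrorE; congr (nat_of_bool _)%:R.
by apply/eqP/eqP => ->; rewrite mirrorK.
Qed.

Lemma starE M x y : star M x y = M (mirror y) (mirror x).
Proof. by rewrite mul_flipr mul_flipl mxE. Qed.

Lemma star_mul M M' : star (M *m M') = star M' *m star M.
Proof.
by rewrite /star trmx_mul !mulmxA -[_ *m flip *m flip]mulmxA flip_flip mulmx1.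
Qed.

Lemma starD M M' : star (M + M') = star M + star M'.
Proof. by apply/matrixP => x y; rewrite !(starE, mxE). Qed.

Lemma starZ a M : star (a *: M) = a *: star M.
Proof. by apply/matrixP => x y; rewrite !(starE, mxE). Qed.

Lemma star1 : star 1%:M = 1%:M :> 'M[R]_N.
Proof. by rewrite /star trmx1 mulmx1 flip_flip. Qed.

Lemma star_skewP M : star M = - M -> (flip *m M)^T = - (flip *m M).
Proof.
move=> sM; rewrite trmx_mul tr_flip -mulmxN -sM /star.
by rewrite -mulmxA flip_mxK.
Qed.

Lemma starK M : star (star M) = M.
Proof. by apply/matrixP => x y; rewrite !starE !mirrorK. Qed.

(** The constant Toeplitz matrices: a complex matrix c, of which only the
    entries between blocks of equal size matter, acts in the same way at every
    position.  On graded matrices phi is a morphism of algebras that turns the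
    conjugate transpose into star. *)
Definition phi c : 'M[R]_N := \matrix_(x, y)
  if (pos x == pos y) && (n (blk x) == n (blk y))
  then cmx (c (blk x) (blk y)) (bit x) (bit y) else 0.

Lemma phiE c x y : phi c x y =
  if (pos x == pos y) && (n (blk x) == n (blk y))
  then cmx (c (blk x) (blk y)) (bit x) (bit y) else 0.
Proof. by rewrite mxE. Qed.

Definition n_graded c := keyed n id c.

Lemma n_graded0 c i j : n_graded c -> n i != n j -> c i j = 0.
Proof. by move=> nc; apply: contra_neq_eq => /nc ->. Qed.

Lemma phi_mul c d : n_graded c -> phi (c *m d) = phi c *m phi d.
Proof.
move=> nc; apply/matrixP => x z; rewrite phiE [RHS]mxE.
case: ifP => [/andP[/eqP pxz /eqP nxz]|/negP nxz]; last first.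
  rewrite [RHS]big1// => y _; rewrite !phiE.
  case: ifP => [/andP[/eqP pxy /eqP nxy]|]; last by rewrite mul0r.
  case: ifP => [/andP[/eqP pyz /eqP nyz]|]; last by rewrite mulr0.
  by case: nxz; rewrite pxy pyz nxy nyz !eqxx.
rewrite (@sum_same_pos _ _ n_gt0 _ _ [pred i | n i == n (blk x)] (pos x)).
- rewrite [(c *m d) _ _]mxE raddf_sum summxE /= [RHS]big_mkcond/=.
  apply: eq_bigr => j _.
  rewrite inE; case: ifPn => [/eqP nj|nj]; last first.
    by rewrite n_graded0 ?mul0r ?cmx0 ?mxE// eq_sym.
  rewrite cmxM mxE; apply: eq_bigr => e _.
  by rewrite !phiE blk_at bit_at pos_at ?nj ?pos_lt// pxz nxz !eqxx.
- by move=> i; rewrite inE => /eqP ->; apply: pos_lt.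
move=> y; rewrite inE negb_and => nxy; rewrite phiE [pos x == _]eq_sym.
rewrite [n (blk x) == _]eq_sym.
by case/orP: nxy => /negPf ->; rewrite ?andbF mul0r.
Qed.

Lemma phi1 : phi 1%:M = 1%:M.
Proof.
apply/matrixP => x y; rewrite phiE [RHS]mxE [1%:M _ _]mxE.
have [->|xy] := eqVneq x y; first by rewrite !eqxx/= mulr1n cmx1 mxE eqxx.
case: ifP => // /andP[/eqP pxy _].
have [bxy|bxy] := eqVneq (blk x) (blk y); last by rewrite cmx0 mxE.
rewrite mulr1n cmx1 mxE [bit x == _](_ : _ = false)//.
by apply: contra_neqF xy => /eqP; apply: idx_inj.
Qed.

Lemma star_phi c : star (phi c) = phi (adj c).
Proof.
apply/matrixP => x y; rewrite starE !phiE !blk_mirror !pos_mirror !bit_mirror.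
rewrite adjE cmx_conj [_^T _ _]mxE [n (blk y) == _]eq_sym.
have [nxy|] := eqVneq (n (blk x)) (n (blk y)); last by rewrite !andbF.
rewrite !andbT; congr (if _ then _ else _).
have := pos_lt x; have := pos_lt y; lia.
Qed.

Lemma phi_alt c : phi c *m alt = alt *m phi c.
Proof.
apply/matrixP => x y; rewrite mul_altl mul_altr mulrC phiE.
by case: ifP => [/andP[/eqP-> _]//|]; rewrite !mulr0.
Qed.

End BlockMatrices.

(** * Toeplitz matrices as a commutant *)
Section Commutant.
Variables (R : realType) (p : nat) (n : 'I_p -> nat).
Hypothesis n_gt0 : forall i, (0 < n i)%N.
Notation N := (blkdim n).
Notation at_pos := (at_pos n_gt0).
Implicit Types (x y z : 'I_N) (M : 'M[R]_N) (c d : 'M[R[i]]_p).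

(** The nilpotent part of the Jordan matrix: I_2 on the first superdiagonal of
    each array. *)
Definition shift : 'M[R]_N := \matrix_(x, y)
  [&& blk x == blk y, pos y == (pos x).+1 & bit x == bit y]%:R.

(** The complex structure: J_2 on each coordinate pair. *)
Definition imag_mx : 'M[R]_N := phi n ('i%:M).

Lemma mul_shiftl M i k e y : (k < n i)%N ->
  (shift *m M) (at_pos i k e) y =
  if (k.+1 < n i)%N then M (at_pos i k.+1 e) y else 0.
Proof.
move=> ki; rewrite mxE; case: ifPn => [k1i|k1i]; last first.
  rewrite big1// => z _; rewrite mxE blk_at pos_at//.
  case: eqP => [iz|]; last by rewrite mul0r.
  case: eqP => [kz|]; last by rewrite mul0r.
  by have := pos_lt z; rewrite -iz kz (negPf k1i).
rewrite (bigD1 (at_pos i k.+1 e))//= [X in _ + X]big1 ?addr0.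
  by rewrite mxE !blk_at !pos_at// !bit_at !eqxx mul1r.
move=> z nz; rewrite mxE blk_at bit_at pos_at//.
case: and3P => [[/eqP iz /eqP kz /eqP ez]|]; last by rewrite mul0r.
by case/eqP: nz; rewrite iz ez -kz at_posK.
Qed.

Lemma mul_shiftrS M x j l f : (l.+1 < n j)%N ->
  (M *m shift) x (at_pos j l.+1 f) = M x (at_pos j l f).
Proof.
move=> lj; rewrite mxE (bigD1 (at_pos j l f))//= [X in _ + X]big1 ?addr0.
  by rewrite mxE !blk_at !pos_at ?(ltnW lj)// !bit_at !eqxx mulr1.
move=> z nz; rewrite mxE blk_at bit_at pos_at// eqSS.
case: and3P => [[/eqP iz /eqP kz /eqP ez]|]; last by rewrite mulr0.
by case/eqP: nz; rewrite -iz -ez kz at_posK.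
Qed.

Lemma mul_shiftr0 M x j f : (M *m shift) x (at_pos j 0%N f) = 0.
Proof.
rewrite mxE big1// => z _; rewrite mxE pos_at// andbF.
by rewrite mulr0.
Qed.

(** Commutation with the shift, entry by entry: the coefficient at (k, l)
    equals the one at (k + 1, l + 1), where coefficients leaving the array
    count as zero. *)
Lemma comm_shiftP M : comm_mx shift M <->
  forall i j e f k l, (k < n i)%N -> (l < n j)%N ->
    (if (k.+1 < n i)%N then M (at_pos i k.+1 e) (at_pos j l f) else 0) =
    if l is l'.+1 then M (at_pos i k e) (at_pos j l' f) else 0.
Proof.
split=> [sM i j e f k l ki lj|sM].
  rewrite -mul_shiftl// sM; case: l lj => [|l] lj; first exact: mul_shiftr0.
  exact: mul_shiftrS.
apply/matrixP => x y; move: x y.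
apply: (at_pos_ind (n_gt0 := n_gt0)) => i k e ki.
apply: (at_pos_ind (n_gt0 := n_gt0)) => j l f lj.
rewrite mul_shiftl// sM//; case: l lj => [|l] lj; first by rewrite mul_shiftr0.
by rewrite mul_shiftrS.
Qed.

Lemma comm_shift_phi c : comm_mx shift (phi n c).
Proof.
apply/comm_shiftP => i j e f k l ki lj.
have [k1i|k1i] := ltnP k.+1 (n i); case: l lj => [|l] lj //;
  rewrite !phiE !blk_at !bit_at !pos_at ?(ltnW lj)//.
case: ifP => // /andP[/eqP kl /eqP nij].
by move: k1i; rewrite nij kl leqNgt lj.
Qed.

Lemma n_graded_scalar (z : R[i]) : n_graded n z%:M.
Proof. by move=> i j; rewrite mxE; have [->|] := eqVneq i j; rewrite ?eqxx. Qed.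

Lemma comm_imag_phi c : n_graded n c -> comm_mx imag_mx (phi n c).
Proof.
move=> nc; rewrite /comm_mx /imag_mx -!(phi_mul n_gt0)//.
  by rewrite scalar_mxC.
exact: n_graded_scalar.
Qed.

Lemma imag_mxE x y : imag_mx x y =
  if (blk x == blk y) && (pos x == pos y) then J2 R (bit x) (bit y) else 0.
Proof.
rewrite phiE J2E [_%:M _ _]mxE; have [->|] := eqVneq (blk x) (blk y).
  by rewrite eqxx andbT /= mulr1n.
by rewrite mulr0n cmx0 mxE if_same.
Qed.

Lemma mul_imagl M i k e y : (k < n i)%N ->
  (imag_mx *m M) (at_pos i k e) y = \sum_g J2 R e g * M (at_pos i k g) y.
Proof.
move=> ki; rewrite mxE (@sum_same_pos _ _ n_gt0 _ _ (pred1 i) k).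
- rewrite big_pred1_eq; apply: eq_bigr => g _.
  by rewrite imag_mxE !blk_at !pos_at// !bit_at !eqxx.
- by move=> _ /eqP->.
move=> z; rewrite inE imag_mxE blk_at pos_at// [i == _]eq_sym [k == _]eq_sym.
by move=> /negPf ->; rewrite mul0r.
Qed.

Lemma mul_imagr M x j l f : (l < n j)%N ->
  (M *m imag_mx) x (at_pos j l f) = \sum_g M x (at_pos j l g) * J2 R g f.
Proof.
move=> lj; rewrite mxE (@sum_same_pos _ _ n_gt0 _ _ (pred1 j) l).
- rewrite big_pred1_eq; apply: eq_bigr => g _.
  by rewrite imag_mxE !blk_at !pos_at// !bit_at !eqxx.
- by move=> _ /eqP->.
by move=> z; rewrite inE imag_mxE blk_at pos_at// => /negPf ->; rewrite mulr0.
Qed.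

Lemma comm_imagP M : comm_mx imag_mx M <->
  forall i j k l, (k < n i)%N -> (l < n j)%N ->
  comm_mx (\matrix_(e, f) M (at_pos i k e) (at_pos j l f)) (J2 R).
Proof.
have E i j k l e f : (k < n i)%N -> (l < n j)%N ->
    let D := \matrix_(e, f) M (at_pos i k e) (at_pos j l f) in
    (J2 R *m D) e f = (imag_mx *m M) (at_pos i k e) (at_pos j l f) /\
    (D *m J2 R) e f = (M *m imag_mx) (at_pos i k e) (at_pos j l f).
  move=> ki lj D; rewrite mul_imagl// mul_imagr// ![(_ *m _) _ _]mxE.
  by split; apply: eq_bigr => g _; rewrite [D _ _]mxE.
split=> [MI i j k l ki lj|MJ]; apply/matrixP.
  by move=> e f; have [-> ->] := E i j k l e f ki lj; rewrite MI.
move=> x y; move: x y.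
apply: (at_pos_ind (n_gt0 := n_gt0)) => i k e ki.
apply: (at_pos_ind (n_gt0 := n_gt0)) => j l f lj.
by have [<- <-] := E i j k l e f ki lj; rewrite (MJ i j k l ki lj).
Qed.

(** Commuting with the shift makes a block constant along its diagonals
    (down).  Diagonals that start in the first column below the corner vanish,
    being the shift of zero, and so do those that leave through the last row
    before the last column: what is left is an upper triangular T preceded by
    zero columns or followed by zero rows. *)
Lemma comm_toeplitz M : comm_mx shift M -> comm_mx imag_mx M ->
  exists2 q, N_upper_toeplitz q M & coef_comm_J2 n q.
Proof.
move=> /comm_shiftP sM /comm_imagP MI.
exists (fun i j t =>
  \matrix_(e, f) M (at_pos i 0%N e) (at_pos j (t + (n j - n i))%N f)).
  apply/upper_toeplitzP => x y; move: x y.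
  apply: (at_pos_ind (n_gt0 := n_gt0)) => i k e ki.
  apply: (at_pos_ind (n_gt0 := n_gt0)) => j l f lj.
  rewrite !blk_at !bit_at !pos_at// mxE.
  have down k' l' : (k' < n i)%N -> (l' < n j)%N -> forall s,
      (k' + s < n i)%N -> (l' + s < n j)%N ->
      M (at_pos i (k' + s) e) (at_pos j (l' + s) f) =
      M (at_pos i k' e) (at_pos j l' f).
    move=> ki' lj'; elim=> [|s IH]; rewrite ?addn0// !addnS => ks ls.
    rewrite -IH; [|lia|lia].
    by have := sM i j e f (k' + s)%N (l' + s).+1; rewrite ks; apply; lia.
  case: ifPn => [le_kl|].
    rewrite (_ : (_ + (n j - n i) = l - k)%N); last by lia.
    rewrite -(down 0%N (l - k)%N _ _ k); try lia.
    by rewrite add0n subnK//; lia.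
  rewrite -ltnNge => lt_lk; have [lk|kl] := ltnP l k.
    transitivity (M (at_pos i (k - l) e) (at_pos j 0 f)).
      by rewrite -(down (k - l)%N 0%N _ _ l) ?add0n ?subnK//; lia.
    have := sM i j e f (k - l).-1 0%N; rewrite prednK ?subn_gt0//.
    by rewrite (_ : (k - l < n i)%N); [apply|]; lia.
  have lji : (l - k + n i < n j)%N by lia.
  transitivity (M (at_pos i 0%N e) (at_pos j (l - k)%N f)).
    by rewrite -(down 0%N (l - k)%N _ _ k) ?add0n ?subnK//; lia.
  have ni := n_gt0 i.
  rewrite -(down 0%N (l - k)%N _ _ (n i).-1) ?add0n; try lia.
  have := sM i j e f (n i).-1 (l - k + (n i).-1).+1.
  by rewrite prednK// ltnn => <- //; lia.
move=> i j t; rewrite ltn_min => /andP[ti tj].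
apply: MI => //; lia.
Qed.

Lemma toeplitz_comm_shift q M : N_upper_toeplitz q M -> comm_mx shift M.
Proof.
move=> /upper_toeplitzP ME; apply/comm_shiftP => i j e f k l ki lj.
have [k1i|k1i] := ltnP k.+1 (n i).
  case: l lj => [|l] lj; rewrite !ME !blk_at !bit_at !pos_at//; try lia.
case: l lj => [|l] lj //; rewrite ME !blk_at !bit_at !pos_at//; try lia.
by rewrite ifN//; lia.
Qed.

Lemma toeplitz_comm_imag q M : N_upper_toeplitz q M -> coef_comm_J2 n q ->
  comm_mx imag_mx M.
Proof.
move=> /upper_toeplitzP ME cJ; apply/comm_imagP => i j k l ki lj.
set D := (D in comm_mx D _).
have -> : D = if (k + (n j - n i) <= l)%N
    then q i j (l - (k + (n j - n i)))%N else 0.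
  apply/matrixP => e f; rewrite mxE ME !blk_at !bit_at !pos_at//.
  by case: ifP; rewrite ?mxE.
by case: ifP => [kl|_]; [apply: cJ; lia|apply: comm0mx].
Qed.

End Commutant.

(** * Weights and the leading part *)
Section Lowering.
Variables (R : realType) (p : nat) (n : 'I_p -> nat).
Hypothesis n_gt0 : forall i, (0 < n i)%N.
Notation N := (blkdim n).
Notation at_pos := (at_pos n_gt0).
Implicit Types (x y z : 'I_N) (M : 'M[R]_N) (c : 'M[R[i]]_p).
Implicit Types (q : 'I_p -> 'I_p -> nat -> 'M[R]_2).

(** With weight 2 * pos - n (blk), a nonzero entry at (x, y) requires the
    weight of y to exceed that of x by at least k.  Centering the weights at
    the middle of each block is what makes every Toeplitz matrix lowering 0,
    whatever the sizes of its two blocks; subtraction is avoided to stay in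
    the natural numbers. *)
Definition lowering k M := forall x y, M x y != 0 ->
  (2 * pos x + n (blk y) + k <= 2 * pos y + n (blk x))%N.

Lemma lowering_mul k l M M' :
  lowering k M -> lowering l M' -> lowering (k + l) (M *m M').
Proof. by move=> kM lM x z /mulmx_neq0[y /kM + /lM]; lia. Qed.

Lemma lowering_add k M M' :
  lowering k M -> lowering k M' -> lowering k (M + M').
Proof.
move=> kM kM' x y; have [Mxy|/kM //] := eqVneq (M x y) 0.
by rewrite mxE Mxy add0r => /kM'.
Qed.

Lemma lowering_scale k a M : lowering k M -> lowering k (a *: M).
Proof. by move=> kM x y; rewrite mxE mulf_eq0 negb_or => /andP[_ /kM]. Qed.

Lemma lowering_le k l M : (l <= k)%N -> lowering k M -> lowering l M.
Proof. by move=> lk kM x y /kM; lia. Qed.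

(** Weights lie between - n i and n i, hence the bound. *)
Lemma lowering_eq0 k M : (3 * \sum_i n i <= k)%N -> lowering k M -> M = 0.
Proof.
move=> k_big kM; apply/matrixP => x y; rewrite [RHS]mxE.
have n_le i : (n i <= \sum_i n i)%N by rewrite (bigD1 i)//= leq_addr.
apply/eqP; rewrite -[_ == _]negbK; apply/negP => /kM.
by have := pos_lt y; have := n_le (blk x); have := n_le (blk y); lia.
Qed.

Lemma toeplitz_lowering q M : N_upper_toeplitz q M -> lowering 0 M.
Proof.
move=> /upper_toeplitzP ME x y; rewrite ME; case: ifP; last by rewrite eqxx.
lia.
Qed.

Lemma phi_lowering c : lowering 0 (phi n c).
Proof.
move=> x y; rewrite phiE; case: ifP; last by rewrite eqxx.
lia.
Qed.

Lemma phi_lowering1 c : n_graded n c -> lowering 1 (phi n c) -> c = 0.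
Proof.
move=> nc c1; apply/matrixP => i j; rewrite mxE.
have [nij|nij] := eqVneq (n i) (n j); last by rewrite (n_graded0 nc).
apply: (@cmx_inj R); apply/matrixP => e f; rewrite cmx0 [RHS]mxE.
apply/eqP; rewrite -[_ == _]negbK; apply/negP => nz.
have := c1 (at_pos i 0%N e) (at_pos j 0%N f).
rewrite phiE !blk_at !bit_at !pos_at// nij !eqxx/= => /(_ nz); lia.
Qed.

Definition lead q : 'M[R[i]]_p := \matrix_(i, j)
  if n i == n j then (q i j 0%N ord0 ord0 +i* q i j 0%N ord0 ord_max)%C else 0.

Lemma lead_graded q : n_graded n (lead q).
Proof.
by move=> i j; rewrite mxE; have [->|_] := eqVneq (n i) (n j); rewrite ?eqxx.
Qed.

(** The only weight-preserving coefficients of a Toeplitz matrix are the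
    diagonal ones of the square blocks. *)
Lemma sub_lead_lowering q M :
  N_upper_toeplitz q M -> coef_comm_J2 n q -> lowering 1 (M - phi n (lead q)).
Proof.
move=> /upper_toeplitzP ME qJ x y; rewrite mxE [(- _ : 'M__) _ _]mxE phiE ME.
have px := pos_lt x; have py := pos_lt y.
have [/andP[/eqP pxy /eqP nxy]|nlev] :=
  boolP ((pos x == pos y) && (n (blk x) == n (blk y))); last first.
  by rewrite subr0; case: ifP => [kl _|_]; [lia|rewrite eqxx].
rewrite nxy pxy subnn addn0 leqnn subnn [lead q _ _]mxE nxy eqxx.
have /comm_J2P {1}-> : comm_mx (q (blk x) (blk y) 0%N) (J2 R).
  by apply: qJ; rewrite ltn_min; lia.
by rewrite subrr eqxx.
Qed.

Lemma comm_mx_inv m (A M : 'M[R]_m) :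
  M \in unitmx -> comm_mx A M -> comm_mx A (invmx M).
Proof.
by move=> uM AM; rewrite /comm_mx -[LHS](mulKmx uM) [M *m _]mulmxA -AM mulmxK.
Qed.

(** A row v killed by the leading part yields a graded matrix E with
    E * lead = 0, so phi E = phi E (M - phi lead) M^-1.  As M^-1 is Toeplitz
    too, the right-hand side strictly lowers weights while phi E preserves
    them: both vanish. *)
Lemma lead_unit q M : N_upper_toeplitz q M -> coef_comm_J2 n q ->
  M \in unitmx -> lead q \in unitmx.
Proof.
move=> MT qJ uM; rewrite -row_free_unit; apply: inj_row_free => v vq.
pose E : 'M[R[i]]_p := \matrix_(i, j) if n i == n j then v 0 j else 0.
have nE : n_graded n E.
  by move=> i j; rewrite mxE; have [->|_] := eqVneq (n i) (n j); rewrite ?eqxx.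
have Eq : E *m lead q = 0.
  apply/matrixP => i k; rewrite mxE [RHS]mxE.
  have [nik|nik] := eqVneq (n i) (n k).
    move/matrixP/(_ 0 k): vq; rewrite [LHS]mxE [RHS]mxE => vqk.
    rewrite -[RHS]vqk; apply: eq_bigr => j _; rewrite [E i j]mxE.
    have [nij|nij] := eqVneq (n i) (n j); first by [].
    by rewrite mul0r (n_graded0 (@lead_graded q)) ?mulr0// -nik eq_sym.
  rewrite big1// => j _; rewrite [E i j]mxE.
  have [nij|nij] := eqVneq (n i) (n j); last by rewrite mul0r.
  by rewrite (n_graded0 (@lead_graded q)) ?mulr0// -nij.
have phi0 : phi n (0 : 'M[R[i]]_p) = 0.
  have z0 i j : (0 : 'M[R[i]]_p) i j = 0 by rewrite mxE.
  by apply/matrixP => x y; rewrite phiE z0 cmx0 !mxE if_same.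
have phiEE : phi n E = phi n E *m (M - phi n (lead q)) *m invmx M.
  by rewrite mulmxBr -(phi_mul n_gt0 _ nE) Eq phi0 subr0 mulmxK.
have [r MiT _] : exists2 r, N_upper_toeplitz r (invmx M) & coef_comm_J2 n r.
  apply: (comm_toeplitz n_gt0); apply: comm_mx_inv => //.
    exact: toeplitz_comm_shift MT.
  exact: toeplitz_comm_imag MT qJ.
have E0 : E = 0.
  apply: phi_lowering1 => //; rewrite phiEE.
  apply: (@lowering_mul 1 0 _ _ _ (toeplitz_lowering MiT)).
  exact: (@lowering_mul 0 1 _ _ (@phi_lowering _) (sub_lead_lowering MT qJ)).
apply/rowP => j; move/matrixP/(_ j j): E0; rewrite mxE eqxx => ->.
by rewrite !mxE.
Qed.

End Lowering.

(** * Removing the unipotent part by congruence *)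
Section Congruence.
Variables (R : realType) (p : nat) (n : 'I_p -> nat).
Hypothesis n_gt0 : forall i, (0 < n i)%N.
Variables (K : eqType) (key : 'I_p -> K).
Notation N := (blkdim n).
Implicit Types (x y z : 'I_N) (M Z S B : 'M[R]_N) (c : 'M[R[i]]_p).

Definition in_commutant M := [/\ comm_mx (shift R n) M,
  comm_mx (imag_mx R n) M & keyed (key \o @blk p n) id M].

Lemma in_commutant1 : in_commutant 1%:M.
Proof. by split; [apply: comm_mx1|apply: comm_mx1|apply: keyed1]. Qed.

Lemma in_commutantM M M' :
  in_commutant M -> in_commutant M' -> in_commutant (M *m M').
Proof.
move=> [s u k] [s' u' k']; split; [exact: comm_mxM|exact: comm_mxM|].
exact: (keyed_mul k k').
Qed.

Lemma in_commutantD M M' :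
  in_commutant M -> in_commutant M' -> in_commutant (M + M').
Proof.
move=> [s u k] [s' u' k']; split; [exact: comm_mxD|exact: comm_mxD|].
exact: (keyed_add k k').
Qed.

Lemma in_commutantZ a M : in_commutant M -> in_commutant (a *: M).
Proof.
move=> [s u k]; rewrite -mul_scalar_mx; split.
- by apply: comm_mxM => //; apply: comm_mx_scalar.
- by apply: comm_mxM => //; apply: comm_mx_scalar.
by rewrite mul_scalar_mx; apply: keyed_scale.
Qed.

Lemma star_congr_skew S B :
  star B = - B -> star (star S *m B *m S) = - (star S *m B *m S).
Proof.
move=> sB; rewrite 2!(star_mul n_gt0) (starK n_gt0) sB.
by rewrite mulNmx mulmxN mulmxA.
Qed.

(** One Newton step towards the inverse square root of 1 + Z: the linear term
    of the error cancels. *)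
Lemma newton_identity m (Z : 'M[R]_m) : let S := 1%:M + (- 2^-1) *: Z in
  S *m (1%:M + Z) *m S =
  1%:M + ((- 3 / 4) *: (Z *m Z) + 4^-1 *: (Z *m Z *m Z)).
Proof.
rewrite /= !(mulmxDl, mulmxDr, mul1mx, mulmx1).
do ![rewrite -scalemxAl | rewrite -scalemxAr].
move: (Z *m Z) => P; move: (P *m Z) => Q.
apply/matrixP => x y; rewrite !mxE; lra.
Qed.

(** Skew-symmetry of both forms gives star Z B0 = B0 Z, which moves star S
    through B0 as S. *)
Lemma newton_step B0 Z : star B0 = - B0 ->
  star (B0 *m (1%:M + Z)) = - (B0 *m (1%:M + Z)) ->
  let S := 1%:M + (- 2^-1) *: Z in
  star S *m (B0 *m (1%:M + Z)) *m S =
  B0 *m (1%:M + ((- 3 / 4) *: (Z *m Z) + 4^-1 *: (Z *m Z *m Z))).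
Proof.
move=> sB0 sB S.
have ZB : star Z *m B0 = B0 *m Z.
  move: sB; rewrite (star_mul n_gt0) (starD n_gt0) (star1 R n_gt0) sB0.
  rewrite mulmxN => /oppr_inj.
  by rewrite mulmxDl mulmxDr mul1mx mulmx1 => /addrI.
have -> : star S *m (B0 *m (1%:M + Z)) = B0 *m S *m (1%:M + Z).
  rewrite mulmxA; congr (_ *m _).
  rewrite /S (starD n_gt0) (star1 R n_gt0) (starZ n_gt0).
  by rewrite mulmxDl mulmxDr mul1mx mulmx1 -scalemxAl ZB scalemxAr.
by rewrite -newton_identity !mulmxA.
Qed.

Lemma unipotent_congruence B0 Z : star B0 = - B0 ->
  star (B0 *m (1%:M + Z)) = - (B0 *m (1%:M + Z)) ->
  in_commutant Z -> lowering 1 Z ->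
  exists2 S, in_commutant S & star S *m (B0 *m (1%:M + Z)) *m S = B0.
Proof.
move=> sB0.
suff H m k : (0 < k)%N -> (3 * \sum_i n i <= k + m)%N -> forall Z,
    star (B0 *m (1%:M + Z)) = - (B0 *m (1%:M + Z)) ->
    in_commutant Z -> lowering k Z ->
    exists2 S, in_commutant S & star S *m (B0 *m (1%:M + Z)) *m S = B0.
  by apply: (H (3 * \sum_i n i)%N 1%N) => //; rewrite leq_addl.
elim: m k => [|m IH] k k_gt0 k_m {}Z sB cZ kZ.
  have -> : Z = 0 by apply: lowering_eq0 kZ; rewrite -[k]addn0.
  exists 1%:M; first exact: in_commutant1.
  by rewrite addr0 !mulmx1 (star1 R n_gt0) mul1mx.
pose S := 1%:M + (- 2^-1) *: Z.
pose Z' := (- 3 / 4) *: (Z *m Z) + 4^-1 *: (Z *m Z *m Z).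
have SE : star S *m (B0 *m (1%:M + Z)) *m S = B0 *m (1%:M + Z').
  exact: newton_step.
have [| | | | |S' cS' S'E] := IH (k + k)%N _ _ Z'.
- by rewrite addn_gt0 k_gt0.
- by apply: leq_trans k_m _; lia.
- by rewrite -SE; apply: star_congr_skew.
- apply: in_commutantD; apply: in_commutantZ; last apply: in_commutantM => //.
    exact: in_commutantM.
  exact: in_commutantM.
- have kZZ : lowering (k + k) (Z *m Z) by apply: lowering_mul.
  apply: lowering_add; apply: lowering_scale => //.
  by apply: lowering_le (lowering_mul kZZ kZ); rewrite leq_addr.
exists (S *m S').
  apply: in_commutantM => //; apply: in_commutantD; first exact: in_commutant1.
  exact: in_commutantZ.
by rewrite (star_mul n_gt0) -[RHS]S'E -SE !mulmxA.
Qed.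

End Congruence.

(** * The leading part of a skew-symmetric alternating matrix *)
Section LeadingPart.
Variables (R : realType) (p : nat) (n : 'I_p -> nat).
Hypothesis n_gt0 : forall i, (0 < n i)%N.
Notation N := (blkdim n).
Notation at_pos := (at_pos n_gt0).
Notation alt := (alt_mx R n).
Notation flip := (flip_mx R n).
Implicit Types (x y z : 'I_N) (M : 'M[R]_N) (c : 'M[R[i]]_p).

(** Mirroring both indices and exchanging them preserves weight differences,
    so star acts separately on the weight-preserving part. *)
Lemma star_lead M c : star (alt *m M) = - (alt *m M) ->
  lowering 1 (M - phi n c) -> star (alt *m phi n c) = - (alt *m phi n c).
Proof.
move=> sM low.
have level x y : (pos x == pos y) && (n (blk x) == n (blk y)) ->
    (alt *m phi n c) x y = (alt *m M) x y.
  move=> lev; rewrite !mul_altl; congr (_ * _); apply/esym/eqP.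
  rewrite -subr_eq0 -[_ == 0]negbK; apply/negP => nz.
  have := low x y; rewrite mxE [(- _ : 'M__) _ _]mxE phiE lev.
  move: nz; rewrite phiE lev => nz /(_ nz); lia.
have off x y : ~~ ((pos x == pos y) && (n (blk x) == n (blk y))) ->
    (alt *m phi n c) x y = 0.
  by move=> nlev; rewrite mul_altl phiE (negPf nlev) mulr0.
apply/matrixP => x y; rewrite (starE n_gt0) [RHS]mxE.
set x' := mirror n_gt0 x; set y' := mirror n_gt0 y.
have lev' : ((pos y' == pos x') && (n (blk y') == n (blk x'))) =
    ((pos x == pos y) && (n (blk x) == n (blk y))).
  rewrite !blk_mirror !pos_mirror.
  by have := pos_lt x; have := pos_lt y; lia.
have [lev|nlev] := boolP ((pos x == pos y) && (n (blk x) == n (blk y))).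
  rewrite !level ?lev'//.
  by have /matrixP/(_ x y) := sM; rewrite (starE n_gt0) [RHS]mxE.
by rewrite !off ?lev'// oppr0.
Qed.

Lemma cmx_sign k (z : R[i]) : cmx ((-1) ^+ k * z) = (-1) ^+ k *: cmx z.
Proof.
elim: k => [|k IH]; first by rewrite !expr0 mul1r scale1r.
by rewrite !exprS !mulN1r mulNr cmxN IH scaleNr.
Qed.

Lemma skew_lead c i j : star (alt *m phi n c) = - (alt *m phi n c) ->
  n i = n j -> (c j i)^* = (-1) ^+ (n i) * c i j.
Proof.
move=> sB nij; apply: (@cmx_inj R); apply/matrixP => e f.
have /matrixP/(_ (at_pos i 0%N e) (at_pos j 0%N f)) := sB.
rewrite (starE n_gt0) [RHS]mxE !mul_altl !phiE.
rewrite !blk_mirror !pos_mirror !bit_mirror.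
rewrite !blk_at !bit_at !pos_at// nij !eqxx/= expr0 mul1r => E.
rewrite cmx_conj cmx_sign [_^T _ _]mxE [RHS]mxE -[cmx (c i j) e f]opprK -E.
rewrite -[in RHS](prednK (n_gt0 j)) exprS mulN1r mulrNN subn1 mulrA -expr2.
by rewrite sqrr_sign mul1r.
Qed.

Lemma signed_rows_flip : signed_rows flip.
Proof.
move=> x; exists (mirror n_gt0 x).
  by left; rewrite (flip_mirrorE R n_gt0) eqxx.
by move=> y /negPf xy; rewrite (flip_mirrorE R n_gt0) xy.
Qed.

Lemma signed_rows_alt : signed_rows alt.
Proof.
move=> x; exists x; last first.
  by move=> y; rewrite alt_mxE eq_sym => /negPf->; rewrite mul0r.
rewrite alt_mxE eqxx mul1r -signr_odd; case: odd; rewrite ?expr1 ?expr0.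
  by right.
by left.
Qed.

Lemma signed_rows_phi c (sg : 'I_p -> 'I_p) (v : 'I_p -> R[i]) :
  (forall i, n (sg i) = n i) ->
  (forall i, v i = 1 \/ v i = -1 \/ v i = 'i \/ v i = - 'i) ->
  (forall i j, c i j = if j == sg i then v i else 0) ->
  signed_rows (phi n c).
Proof.
move=> nsg vP cE x; have [f fP f0] := signed_rows_cmx (vP (blk x)) (bit x).
have px : (pos x < n (sg (blk x)))%N by rewrite nsg pos_lt.
exists (at_pos (sg (blk x)) (pos x) f).
  by rewrite phiE blk_at pos_at// bit_at nsg !eqxx cE eqxx.
move=> z nz; rewrite phiE; case: ifP => // /andP[/eqP pxz _].
rewrite cE; case: eqP => [bz|_]; last by rewrite cmx0 mxE.
apply: f0; apply: contra_neq nz => zf; rewrite -bz -zf pxz.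
by rewrite at_posK.
Qed.

(** The phases u, equal to i on the blocks of odd size, make D c Hermitian.  As
    they depend on the size only and s does not mix sizes, D commutes with
    adj s and the phases can be removed after the elimination. *)
Lemma twisted_hermitian_matching (K : eqType) (key : 'I_p -> K)
    (tau : K -> K) c :
  c \in unitmx -> n_graded n c -> keyed key tau c ->
  (forall i j, n i = n j -> (c j i)^* = (-1) ^+ (n i) * c i j) ->
  exists s, [/\ n_graded n s, keyed key id s &
    signed_rows (phi n (adj s *m c *m s))].
Proof.
move=> uc nc kc hc.
pose u i : R[i] := if odd (n i) then 'i else 1.
have u_neq0 i : u i != 0.
  by rewrite /u; case: ifP => _; rewrite ?neq0Ci ?oner_eq0.
pose D : 'M[R[i]]_p := diag_mx (\row_i u i).
pose h := D *m c.
have hE i j : h i j = u i * c i j by rewrite /h /D mul_diag_mx !mxE.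
have hh : adj h = h.
  apply/matrixP => i j; rewrite adjE !hE.
  have [nij|nij] := eqVneq (n i) (n j); last first.
    by rewrite !(n_graded0 nc) ?mulr0 ?conjC0// eq_sym.
  rewrite rmorphM/= hc// /u -nij -signr_odd.
  case: odd; rewrite ?conjC1 ?conjCi ?expr1 ?expr0 ?mulrA ?mulrN1 ?opprK//.
  by rewrite !mul1r.
have uh : h \in unitmx.
  rewrite unitmx_mul uc andbT unitmxE det_diag unitfE.
  by apply/prodf_neq0 => i _; rewrite mxE.
pose key' i := (n i, key i).
pose tau' (k : nat * K) := (k.1, tau k.2).
have kh : keyed key' tau' h.
  move=> i j; rewrite hE mulf_eq0 negb_or => /andP[_ cij].
  by rewrite /key' /tau' /= (nc _ _ cij) (kc _ _ cij).
have [s [sg [th [ks thP sE]]]] := hermitian_signed_matching hh uh kh.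
have ns : n_graded n s by move=> i j /ks[].
have Ds : adj s *m D = D *m adj s.
  apply/matrixP => i j; rewrite /D mul_diag_mx mul_mx_diag !mxE mulrC.
  have [->|/ns] := eqVneq (s j i) 0; first by rewrite conjC0 !mulr0.
  by rewrite /u => ->.
pose c0 := adj s *m c *m s.
have c0E i j : c0 i j = if j == sg i then (u i)^-1 * th i else 0.
  have : (D *m c0) i j = (adj s *m h *m s) i j.
    by rewrite /c0 /h !mulmxA Ds.
  rewrite sE /D mul_diag_mx mxE [(\row__ _) _ _]mxE => E.
  rewrite -[LHS](mulKf (u_neq0 i)) E; case: ifP => // _; exact: mulr0.
exists s; split=> //; first by move=> i j /ks[].
apply: (signed_rows_phi _ _ c0E) => i.
  have : c0 i (sg i) != 0.
    rewrite c0E eqxx mulf_neq0 ?invr_eq0//.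
    by case: (thP i) => ->; rewrite ?oppr_eq0 oner_eq0.
  exact: (keyed_congr ns nc).
rewrite /u; case: ifP => _; case: (thP i) => ->.
- by do 3!right; rewrite mulr1 invCi.
- by do 2!right; left; rewrite mulrN1 invCi opprK.
- by left; rewrite invr1 mulr1.
by right; left; rewrite invr1 mul1r.
Qed.

End LeadingPart.
Theorem proposition5p17 (R : realType) (p : nat) (n : 'I_p -> nat)
    (a b : 'I_p -> R) (n_gt0 : forall i, (0 < n i)%N)
    (b_gt0 : forall i, 0 < b i)
    (J : 'M[R]_(blkdim n)) (defJ : J = jordan_mx n a b)
    (B : 'M[R]_(blkdim n)) (hB : HJ a b (blkdim n) B) :
  exists S P : 'M[R]_(blkdim n),
    [/\ TJ a b S, is_perm_mx P
      & star S *m B *m S = flip_mx R n *m P^T *m JN R n *m P].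
Proof.
case: hB => skB [q [M MT BE] qJ] rB zB.
pose key i := (a i, b i); pose tau (k : R * R) := (- k.1, k.2).
have tauK : involutive tau by case=> u v; rewrite /tau /= opprK.
have /andP[_ uM] : (alt_mx R n \in unitmx) && (M \in unitmx).
  by rewrite -unitmx_mul -BE -row_free_unit /row_free rB.
have kB : keyed (key \o @blk p n) tau B.
  move=> x y; apply: contra_neq_eq => kxy.
  have /submxblock_eq0 -> // : submxblock B (blk x) (blk y) = 0.
  by apply: zB => E; case/eqP: kxy; rewrite /= /key -E.
have MB : M = alt_mx R n *m B by rewrite BE alt_mxK.
have kM : keyed (key \o @blk p n) tau M.
  by move=> x y; rewrite MB mul_altl mulf_eq0 negb_or => /andP[_ /kB].
pose c := lead n q.
have nc : n_graded n c by apply: lead_graded.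
have uc : c \in unitmx by apply: lead_unit MT qJ uM.
have low := sub_lead_lowering MT qJ; rewrite -/c in low.
have kc : keyed key tau c.
  move=> i j; apply: contra_neq_eq => kij; rewrite mxE.
  case: eqVneq => // nij.
  have q0 e f : q i j 0%N e f = 0.
    have /upper_toeplitzP
      /(_ (at_pos n_gt0 i 0%N e) (at_pos n_gt0 j 0%N f)) := MT.
    rewrite !blk_at !bit_at !pos_at// nij subnn /= => <-.
    apply/eqP; rewrite -[_ == _]negbK; apply/negP => /kM /=.
    by rewrite !blk_at; apply/eqP.
  by rewrite !q0.
rewrite BE in skB *.
(* normalise the leading part by elimination *)
have skB0 := star_lead n_gt0 skB low.
have [s [ns ks ss]] := twisted_hermitian_matching n_gt0 uc nc kc
  (fun i j => skew_lead n_gt0 skB0).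
have nic : n_graded n (invmx c) by apply: keyed_inv.
have cic : phi n c *m phi n (invmx c) = 1%:M.
  by rewrite -(phi_mul n_gt0)// mulmxV// phi1.
(* the rest of M is a unipotent factor 1 + Z *)
pose Z := phi n (invmx c) *m (M - phi n c).
have MZ : M = phi n c *m (1%:M + Z).
  by rewrite mulmxDr mulmx1 mulmxA cic mul1mx addrC subrK.
have kphi t d : keyed key t d -> keyed (key \o @blk p n) t (phi n d).
  move=> kd x y; rewrite phiE; case: ifP => [_ nz|]; last by rewrite eqxx.
  by apply: kd; apply: contra_neq nz => ->; rewrite cmx0 mxE.
have cZ : in_commutant key Z.
  split.
  - apply: comm_mxM (comm_mxB _ _); try exact: comm_shift_phi n_gt0 _.
    exact: toeplitz_comm_shift MT.
  - apply: comm_mxM (comm_mxB _ _); try exact: comm_imag_phi.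
    exact: toeplitz_comm_imag MT qJ.
  apply: (@keyed_ext _ _ _ _ (tau \o tau)) => //.
  apply: keyed_mul; first by apply: kphi; apply: keyed_inv.
  by apply: keyed_add kM _; apply/keyed_opp/kphi.
have Zlow : lowering 1 Z.
  by apply: (@lowering_mul _ _ _ 0 1) => //; apply: phi_lowering.
have [S0 cS0 S0E] : exists2 S0, in_commutant key S0 &
    star S0 *m (alt_mx R n *m M) *m S0 = alt_mx R n *m phi n c.
  rewrite MZ mulmxA; apply: unipotent_congruence => //.
  by rewrite -mulmxA -MZ.
pose S := S0 *m phi n s.
have cS : in_commutant key S.
  apply: in_commutantM => //; split; last exact: kphi.
    exact: comm_shift_phi.
  exact: comm_imag_phi.
(* a constant congruence commutes with alt and acts on c alone *)
have SE : star S *m (alt_mx R n *m M) *m S =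
    alt_mx R n *m phi n (adj s *m c *m s).
  transitivity (star (phi n s) *m
      (star S0 *m (alt_mx R n *m M) *m S0) *m phi n s).
    by rewrite (star_mul n_gt0) !mulmxA.
  have nas : n_graded n (adj s).
    by move=> i j; rewrite adjE conjC_eq0 => /ns.
  have nasc : n_graded n (adj s *m c) by apply: keyed_mul nas nc.
  rewrite S0E (star_phi n_gt0) mulmxA phi_alt.
  by rewrite -!mulmxA mulmxA (phi_mul n_gt0)// (phi_mul n_gt0)// !mulmxA.
pose Q := flip_mx R n *m (star S *m (alt_mx R n *m M) *m S).
have Qrows : signed_rows Q.
  rewrite /Q SE; apply: signed_rows_mul; first exact: signed_rows_flip.
  by apply: signed_rows_mul => //; apply: signed_rows_alt.
have Qskew : Q^T = - Q.
  by apply: star_skewP => //; apply: star_congr_skew.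
have [P permP QE] := skew_signed_rows_JN (blkdimE n) Qskew Qrows.
exists S, P; split=> //; last first.
  by rewrite -[LHS](flip_mxK n_gt0) -/Q QE !mulmxA.
have [sS uS kS] := cS.
split; last 1 first.
- move=> i j kij; apply/submxblock_eq0 => x y xi yj; apply/eqP.
  rewrite -[_ == _]negbK; apply/negP => /kS /=; rewrite xi yj.
  by move=> E; case: kij.
(* S is invertible because the form it produces is nondegenerate *)
- have := signed_rows_unit Qskew Qrows.
  by rewrite !unitmx_mul => /and3P[_ _ ->].
exact: comm_toeplitz.
Qed.
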